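(* Consider two one-sided adaptive conformal inference (ACI) procedures run separately in parallel, one for the lower tail (sign $-$) and one for the upper tail (sign $+$), with target levels $\alpha^\pm\in(0,1)$, the same step size $\gamma>0$ and initial levels $\alpha_1^\pm\in[0,1]$: $$\alpha^\pm_{i+1}=\alpha_i^\pm+\gamma\,(\alpha^\pm-\mathrm{err}_i^\pm),\qquad \mathrm{err}_i^-=\mathbf 1\{Y_i\notin\mathcal C^{L}_{i,\alpha_i^-}\},\quad \mathrm{err}_i^+=\mathbf 1\{Y_i\notin\mathcal C^{U}_{i,\alpha_i^+}\},\qquad i\ge1.$$ Assume that the empirical quantile functions $\widehat Q^{L}_i,\widehat Q^{U}_i$ used to build the one-sided prediction sets are non-decreasing, with $\widehat Q^{L}_i(x)=\widehat Q^{U}_i(x)=-\infty$ for $x<0$ and $\widehat Q^{L}_i(x)=\widehat Q^{U}_i(x)=+\infty$ for $x>1$. No assumption (in particular no exchangeability) is made on the distribution of the data sequence. Let $$\mathrm{err}_i^{\mathrm{tot}}:=\mathrm{err}_i^-+\mathrm{err}_i^+,\qquad \alpha^{\mathrm{tot}}:=\alpha^-+\alpha^+$$ be the observed and target miscoverage of the intersection interval $\mathcal C^{\cap}_{i,\underline\alpha_i}=\mathcal C^{L}_{i,\alpha_i^-}\cap\mathcal C^{U}_{i,\alpha_i^+}$, $\underline\alpha_i=(\alpha_i^-,\alpha_i^+)$. Then, with probability one, for every $N\in\mathbb N$ ($N\ge1$), $$\left|\frac1N\sum_{i=1}^N\mathrm{err}_i^{\mathrm{tot}}-\alpha^{\mathrm{tot}}\right|\le\frac{\max\{\alpha_1^-+\alpha_1^+,\;2-(\alpha_1^-+\alpha_1^+)\}+2\gamma}{N\gamma}.$$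 In particular, $\frac1N\sum_{i=1}^N\mathrm{err}_i^{\mathrm{tot}}\to\alpha^{\mathrm{tot}}$ almost surely as $N\to\infty$.
   Context: The online data are an arbitrary sequence of random pairs $(X_i,Y_i)_{i\ge1}$ with $X_i\in\mathbb R^p$, $Y_i\in\mathbb R$ (indexed from $1$ after an initial sample used for initialization). At each time $i$, from past data one has real-valued lower and upper conformity score functions $s_i^L(x,y)$, $s_i^U(x,y)$ and corresponding empirical quantile functions $\widehat Q_i^L,\widehat Q_i^U:\mathbb R\to[-\infty,+\infty]$ (of calibration scores). For $a\in\mathbb R$, the one-sided prediction sets at miscoverage level $a$ are $$\mathcal C^{L}_{i,a}=\{y\in\mathbb R: s_i^L(X_i,y)\le\widehat Q_i^L(1-a)\},\qquad \mathcal C^{U}_{i,a}=\{y\in\mathbb R: s_i^U(X_i,y)\le\widehat Q_i^U(1-a)\}.$$ The set $\mathcal C^L$ is a lower-bounded interval of the form $[L,\infty)$ and $\mathcal C^U$ an upper-bounded one $(-\infty,U]$ (possibly degenerate: equal to $\mathbb R$ or empty). An expression with $\pm$ is a pair of statements, one for each sign. *)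

(* Defs.v *)
From HB Require Import structures.
From mathcomp Require Import all_boot all_order all_algebra.
From mathcomp Require Import all_classical all_reals all_analysis.

Set Implicit Arguments.
Unset Strict Implicit.
Unset Printing Implicit Defensive.

Import Order.TTheory GRing.Theory Num.Theory.
Import numFieldNormedType.Exports.

Local Open Scope classical_set_scope.
Local Open Scope ring_scope.

(* What is known before time i (online times start at 1): the initial
   information, and the pairs observed at times 1, ..., i - 1, in this order. *)
Definition past_data (Omega I0 V R : Type) (init : Omega -> I0)
    (X : nat -> Omega -> V) (Y : nat -> Omega -> R) (i : nat) (w : Omega) :
    I0 * seq (V * R) :=
  (init w, [seq (X j w, Y j w) | j <- iota 1 i.-1]).

Definition prediction_set (R : realType) (V : Type)
    (s : V -> R -> R) (Q : R -> \bar R) (x : V) (a : R) : set R :=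
  [set y | ((s x y)%:E <= Q (1 - a)%R)%E].

Definition quantile_condition (R : realType) (Q : R -> \bar R) : Prop :=
  [/\ {homo Q : x y / (x <= y)%R >-> (x <= y)%E},
      forall x : R, x < 0 -> Q x = -oo%E
    & forall x : R, 1 < x -> Q x = +oo%E].

(* The empty set and the whole line are the degenerate cases. *)
Definition lower_bounded_interval (R : realType) (C : set R) : Prop :=
  [\/ C = set0, C = setT | exists l : R, C = `[l, +oo[%classic].

Definition upper_bounded_interval (R : realType) (C : set R) : Prop :=
  [\/ C = set0, C = setT | exists u : R, C = `]-oo, u]%classic].

(* Main.v *)
Require Import Defs.
From HB Require Import structures.
From mathcomp Require Import all_boot all_order all_algebra.
From mathcomp Require Import all_classical all_reals all_analysis.
From mathcomp Require Import ring lra.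

(** The prediction sets are all of [R] when the level is negative and empty when
    it exceeds 1, so each level is pushed back once it leaves [0, 1] and, its
    steps being smaller than [gamma], never leaves [-gamma, 1 + gamma].  The
    recursion telescopes: the accumulated deviation of the errors from the
    target is (first level - last level) / gamma, hence bounded. *)

Set Implicit Arguments.
Unset Strict Implicit.
Unset Printing Implicit Defensive.

Import Order.TTheory GRing.Theory Num.Theory.
Import numFieldNormedType.Exports.

Local Open Scope classical_set_scope.
Local Open Scope ring_scope.

(** Here [1 - a] exceeds 1, where the quantile is [+oo]; symmetrically, a level above 1 makes
    [1 - a] negative and the quantile [-oo], below every real score. *)
Lemma prediction_set_lt0 (R : realType) (V : Type) (s : V -> R -> R)
    (Q : R -> \bar R) (x : V) (a : R) :
  quantile_condition Q -> a < 0 -> prediction_set s Q x a = setT.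
Proof.
case=> _ _ Qgt1 a_lt0; apply/seteqP; split=> y //= _.
by rewrite /prediction_set /= Qgt1 ?leey//; lra.
Qed.

Lemma prediction_set_gt1 (R : realType) (V : Type) (s : V -> R -> R)
    (Q : R -> \bar R) (x : V) (a : R) :
  quantile_condition Q -> 1 < a -> prediction_set s Q x a = set0.
Proof.
case=> _ Qlt0 _ a_gt1; apply/seteqP; split=> y //=.
by rewrite /prediction_set /= Qlt0 ?leeNy_eq//; lra.
Qed.

(** Interface between the prediction sets and the level recursion: these three facts are what
    [aci_level_bounds] asks of the errors. *)
Lemma prediction_set_err (R : realType) (V : Type) (s : V -> R -> R)
    (Q : R -> \bar R) (x : V) (a y : R) :
  quantile_condition Q ->
  let err : R := \1_(~` prediction_set s Q x a) y in
  [/\ 0 <= err <= 1, a < 0 -> err = 0 & 1 < a -> err = 1].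
Proof.
move=> hQ /=; split.
- by rewrite indicE; case: (_ \in _); rewrite /= ?lexx ler01.
- by move=> a_lt0; rewrite prediction_set_lt0// setCT indic0.
- by move=> a_gt1; rewrite prediction_set_gt1// setC0 indicT.
Qed.

(** Induction on [i], by the position of the current level. Below 0 the step is [gamma * target],
    upwards by at most [gamma]; above 1 it is [gamma * (target - 1)], downwards by at most [gamma];
    within [0, 1] it is at most [gamma] in absolute value. *)
Lemma aci_level_bounds (R : realFieldType)
    (target gamma : R) (level err : nat -> R) :
  0 < gamma ->
  (forall i, (1 <= i)%N ->
    level i.+1 = level i + gamma * (target - err i)) ->
  0 < target < 1 -> 0 <= level 1%N <= 1 ->
  (forall i, (1 <= i)%N ->
    [/\ 0 <= err i <= 1, level i < 0 -> err i = 0 & 1 < level i -> err i = 1]) ->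
  forall i, (1 <= i)%N -> - gamma <= level i <= 1 + gamma.
Proof.
move=> gamma_gt0 levelS /andP[target_gt0 target_lt1] /andP[level1_ge0 level1_le1]
  errP.
elim=> [//|[_ _|i IHi _]]; first by apply/andP; split; lra.
have [/andP[err_ge0 err_le1] err_lt0 err_gt1] := errP i.+1 isT.
rewrite levelS//; have /andP[IHge IHle] := IHi isT.
(* Once expanded, the products [gamma * target] and [gamma * err i.+1] are atoms for [lra], each to
   be bounded between 0 and [gamma]. *)
rewrite mulrBr.
have gt_ge0 : 0 <= gamma * target by rewrite mulr_ge0// ltW.
have gt_le : gamma * target <= gamma by rewrite ler_piMr// ltW.
have [level_lt0|level_ge0] := ltP (level i.+1) 0.
  by rewrite err_lt0// mulr0; apply/andP; split; lra.
have [level_gt1|level_le1] := ltP 1 (level i.+1).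
  by rewrite err_gt1// mulr1; apply/andP; split; lra.
have ge_ge0 : 0 <= gamma * err i.+1 by rewrite mulr_ge0// ltW.
have ge_le : gamma * err i.+1 <= gamma by rewrite ler_piMr// ltW.
by apply/andP; split; lra.
Qed.

(** Kept multiplied by [gamma], so that the identity holds in any commutative ring. *)
Lemma aci_telescope (R : comRingType)
    (target gamma : R) (level err : nat -> R) (N : nat) :
  (forall i, (1 <= i)%N ->
    level i.+1 = level i + gamma * (target - err i)) ->
  gamma * (\sum_(1 <= i < N.+1) err i - N%:R * target) =
  level 1%N - level N.+1.
Proof.
move=> levelS; elim: N => [|N IHN].
  by rewrite big_geq// mul0r !subrr mulr0.
rewrite big_nat_recr//= (levelS N.+1 isT) -natr1.
by rewrite -[level 1%N](subrK (level N.+1)) -IHN; ring.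
Qed.

Lemma cvg_of_rate (R : realType) (u : nat -> R) (l K : R) :
  (forall N, (1 <= N)%N -> `|u N - l| <= K / N%:R) -> u @ \oo --> l.
Proof.
(* The shift skips [N = 0], where no bound is assumed, and turns the rate into [K * harmonic n]. *)
move=> hu; rewrite -cvg_shiftS; apply/cvgrPdistC_lt => e e0.
have : (fun n => K * harmonic n) @ \oo --> (0 : R).
  by rewrite -(mulr0 K); apply: cvgMr; exact: cvg_harmonic.
move=> /cvgr0_norm_lt /(_ e e0); apply: filterS => n.
apply: le_lt_trans; apply: le_trans (hu n.+1 isT) _.
(* [K] has no prescribed sign, hence the passage to the absolute value of [K * harmonic n]. *)
exact: ler_norm.
Qed.

Theorem theorem4p2 (R : realType) (d : measure_display)
    (Omega : measurableType d) (P : probability Omega R) (p : nat)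
    (* the data; only the indices i >= 1 are used *)
    (X : nat -> {RV P >-> p.-tuple R}) (Y : nat -> {RV P >-> R})
    (I0 : Type) (init : Omega -> I0)
    (* scores and quantile functions, computed from past data *)
    (sL sU : nat -> I0 * seq (p.-tuple R * R) -> p.-tuple R -> R -> R)
    (QL QU : nat -> I0 * seq (p.-tuple R * R) -> R -> \bar R)
    (CL CU : nat -> Omega -> R -> set R)
    (targetL targetU gamma levelL1 levelU1 : R)
    (levelL levelU errL errU errtot : nat -> Omega -> R)
    (HCL : forall i w a, (1 <= i)%N ->
      CL i w a = prediction_set (sL i (past_data init X Y i w))
                   (QL i (past_data init X Y i w)) (X i w) a)
    (HCU : forall i w a, (1 <= i)%N ->
      CU i w a = prediction_set (sU i (past_data init X Y i w))
                   (QU i (past_data init X Y i w)) (X i w) a)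
    (HCLint : forall i w a, (1 <= i)%N -> lower_bounded_interval (CL i w a))
    (HCUint : forall i w a, (1 <= i)%N -> upper_bounded_interval (CU i w a))
    (HQL : forall i w, (1 <= i)%N ->
      quantile_condition (QL i (past_data init X Y i w)))
    (HQU : forall i w, (1 <= i)%N ->
      quantile_condition (QU i (past_data init X Y i w)))
    (HtargetL : 0 < targetL < 1) (HtargetU : 0 < targetU < 1)
    (Hgamma : 0 < gamma)
    (HlevelL1 : 0 <= levelL1 <= 1) (HlevelU1 : 0 <= levelU1 <= 1)
    (HlevelLinit : forall w, levelL 1%N w = levelL1)
    (HlevelUinit : forall w, levelU 1%N w = levelU1)
    (HerrL : forall i w, (1 <= i)%N ->
      errL i w = \1_(~` CL i w (levelL i w)) (Y i w))
    (HerrU : forall i w, (1 <= i)%N ->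
      errU i w = \1_(~` CU i w (levelU i w)) (Y i w))
    (HlevelLrec : forall i w, (1 <= i)%N ->
      levelL i.+1 w = levelL i w + gamma * (targetL - errL i w))
    (HlevelUrec : forall i w, (1 <= i)%N ->
      levelU i.+1 w = levelU i w + gamma * (targetU - errU i w))
    (Herrtot : forall i w, (1 <= i)%N -> errtot i w = errL i w + errU i w) :
  {ae P, forall w, forall N : nat, (1 <= N)%N ->
    `|N%:R^-1 * (\sum_(1 <= i < N.+1) errtot i w) - (targetL + targetU)|
    <= (Num.max (levelL1 + levelU1) (2 - (levelL1 + levelU1)) + 2 * gamma)
       / (N%:R * gamma)}
  /\
  {ae P, forall w,
    (fun N : nat => N%:R^-1 * (\sum_(1 <= i < N.+1) errtot i w)) @ \oo
      --> targetL + targetU}.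
Proof.
(* The bound is deterministic: it holds on every path [w], and both almost sure claims follow from
   it. *)
have bound w N : (1 <= N)%N ->
    `|N%:R^-1 * (\sum_(1 <= i < N.+1) errtot i w) - (targetL + targetU)|
    <= (Num.max (levelL1 + levelU1) (2 - (levelL1 + levelU1)) + 2 * gamma)
       / (N%:R * gamma).
  move=> N_gt0.
  have errLP i : (1 <= i)%N -> [/\ 0 <= errL i w <= 1,
      levelL i w < 0 -> errL i w = 0 & 1 < levelL i w -> errL i w = 1].
    by move=> i_gt0; rewrite HerrL// HCL//; apply: prediction_set_err; exact: HQL.
  have errUP i : (1 <= i)%N -> [/\ 0 <= errU i w <= 1,
      levelU i w < 0 -> errU i w = 0 & 1 < levelU i w -> errU i w = 1].
    by move=> i_gt0; rewrite HerrU// HCU//; apply: prediction_set_err; exact: HQU.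
  have recL i (i_gt0 : (1 <= i)%N) := HlevelLrec i w i_gt0.
  have recU i (i_gt0 : (1 <= i)%N) := HlevelUrec i w i_gt0.
  (* The bounds are taken at [N.+1], the index of the last level left by the telescoping. *)
  have := aci_level_bounds Hgamma recL HtargetL.
  rewrite HlevelLinit => /(_ HlevelL1 errLP N.+1 isT) boundL.
  have := aci_level_bounds Hgamma recU HtargetU.
  rewrite HlevelUinit => /(_ HlevelU1 errUP N.+1 isT) boundU.
  have := aci_telescope N recL; rewrite HlevelLinit => teleL.
  have := aci_telescope N recU; rewrite HlevelUinit => teleU.
  rewrite (eq_big_nat _ _ (F2 := fun i => errL i w + errU i w)); last first.
    by move=> i /andP[i_gt0 _]; exact: Herrtot.
  rewrite big_split /=.
  move: teleL teleU; set SL := \sum_(_ <= _ < _) errL _ _.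
  set SU := \sum_(_ <= _ < _) errU _ _ => teleL teleU.
  have N0 : 0 < N%:R :> R by rewrite ltr0n.
  have Ng0 : 0 < N%:R * gamma by rewrite mulr_gt0.
  (* Clearing the denominator [N * gamma] inside the absolute value leaves the sum of the two
     telescoped identities. *)
  rewrite ler_pdivlMr// -[X in _ * X <= _](gtr0_norm Ng0) -normrM.
  have -> : (N%:R^-1 * (SL + SU) - (targetL + targetU)) * (N%:R * gamma) =
      (levelL1 + levelU1) - (levelL N.+1 w + levelU N.+1 w).
    transitivity (gamma * (SL - N%:R * targetL) + gamma * (SU - N%:R * targetU)).
      by field; rewrite gt_eqF.
    by rewrite teleL teleU; ring.
  (* The last two levels sum to a value in [[-2 * gamma, 2 + 2 * gamma]]. Its lower end gives the
     first argument of the maximum, its upper end the second, each with the extra [2 * gamma]. *)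
  have [max1 max2] : levelL1 + levelU1 <=
        Num.max (levelL1 + levelU1) (2 - (levelL1 + levelU1)) /\
      2 - (levelL1 + levelU1) <=
        Num.max (levelL1 + levelU1) (2 - (levelL1 + levelU1)).
    by rewrite !le_max !lexx orbT.
  by rewrite ler_norml; apply/andP; split; lra.
split; first by apply: aeW => w N; exact: bound.
apply: aeW => w; apply: cvg_of_rate => N N_gt0.
apply: le_trans (bound w N N_gt0) _.
(* Regrouping the quotient fixes the constant [K] of [cvg_of_rate] as the numerator of the bound
   divided by [gamma]. *)
by rewrite [N%:R * _]mulrC invfM mulrA.
Qed.
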